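(* Let $X\subset\mathbb{R}^d$ and let $h_1,\dots,h_r:X\to\mathbb{R}$ be arbitrarily fixed functions. The following assertions hold. 1) Suppose $X$ contains cycles with respect to $h_1,\dots,h_r$. A function $f:X\to\mathbb{R}$ belongs to $\mathcal{B}(h_1,\dots,h_r;X)$ if and only if $G_p(f)=0$ for every minimal cycle $p\subset X$ with respect to $h_1,\dots,h_r$. 2) Suppose $X$ contains no cycles with respect to $h_1,\dots,h_r$. Then $\mathcal{B}(h_1,\dots,h_r;X)=T(X)$.
   Context: $T(X)$ is the set of all functions $X\to\mathbb{R}$, and $$\mathcal{B}(h_1,\dots,h_r;X)=\Big\{x\mapsto\sum_{i=1}^r g_i(h_i(x)),\ x\in X:\ g_i:\mathbb{R}\to\mathbb{R},\ i=1,\dots,r\Big\}$$ (the $g_i$ are arbitrary functions). For a real number $a$, $\delta_a:\mathbb{R}\to\mathbb{R}$ denotes the characteristic function of the one-point set $\{a\}$. A finite set of (distinct) points $\{x_1,\dots,x_n\}\subset X$ is called a cycle with respect to $h_1,\dots,h_r$ if there is a vector $\lambda=(\lambda_1,\dots,\lambda_n)$ with all coordinates nonzero real numbers such that $\sum_{j=1}^n\lambda_j\delta_{h_i(x_j)}=0$ for every $i=1,\dots,r$. A cycle is minimal if it does not contain any cycle as a proper subset. For a minimal cycle $p=\{x_1,\dots,x_n\}$ the vector $\lambda$ is unique up to multiplication by a constant; normalizing it by $\sum_{j=1}^n|\lambda_j|=1$ one defines, uniquely up to sign, the functional $G_p(f)=\sum_{j=1}^n\lambda_jf(x_j)$. 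*)

(* Defs.v *)
From HB Require Import structures.
From mathcomp Require Import all_boot all_order all_algebra.
From mathcomp Require Export finmap.
From mathcomp Require Import all_classical all_reals.
From mathcomp Require Import numfun.

Set Implicit Arguments.
Unset Strict Implicit.
Unset Printing Implicit Defensive.

Import Order.TTheory GRing.Theory Num.Theory.

Local Open Scope classical_set_scope.
Local Open Scope ring_scope.

(* The definitions only use that X has decidable equality and choice; a subset
   of R^d is an instance, through the coercion [set_type] from sets to types. *)

Definition superpositions (R : realType) (X : Type) (r : nat)
    (h : 'I_r -> X -> R) : set (X -> R) :=
  [set f | exists g : 'I_r -> R -> R, forall x, f x = \sum_(i < r) g i (h i x)].

Definition cycle_vector (R : realType) (X : choiceType) (r : nat)
    (h : 'I_r -> X -> R) (p : {fset X}) (lam : {ffun p -> R}) : Prop :=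
  (forall x : p, lam x != 0) /\
  (forall (i : 'I_r) (t : R),
     \sum_(x : p) lam x * \1_[set h i (val x)] t = 0).

(* The empty set satisfies the equations vacuously and has to be excluded:
   otherwise it would be contained in every cycle. *)
Definition is_cycle (R : realType) (X : choiceType) (r : nat)
    (h : 'I_r -> X -> R) (p : {fset X}) : Prop :=
  p != fset0 /\ exists lam : {ffun p -> R}, cycle_vector h lam.

Definition minimal_cycle (R : realType) (X : choiceType) (r : nat)
    (h : 'I_r -> X -> R) (p : {fset X}) : Prop :=
  is_cycle h p /\ (forall q : {fset X}, (q `<` p)%fset -> ~ is_cycle h q).

Definition normalized_cycle_vector (R : realType) (X : choiceType) (r : nat)
    (h : 'I_r -> X -> R) (p : {fset X}) (lam : {ffun p -> R}) : Prop :=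
  cycle_vector h lam /\ \sum_(x : p) `|lam x| = 1.

(* The sign is fixed by choice; [normalized_cycle_vector_ex] and
   [normalized_cycle_vector_uniq] show that for a minimal cycle nothing else
   is chosen. The default value 0 is only reached when p is not a cycle. *)
Definition cycle_weights (R : realType) (X : choiceType) (r : nat)
    (h : 'I_r -> X -> R) (p : {fset X}) : {ffun p -> R} :=
  xget 0 [set lam | normalized_cycle_vector h lam].

Definition cycle_functional (R : realType) (X : choiceType) (r : nat)
    (h : 'I_r -> X -> R) (p : {fset X}) (f : X -> R) : R :=
  \sum_(x : p) cycle_weights h p x * f (val x).

Lemma normalized_cycle_vector_ex (R : realType) (X : choiceType) (r : nat)
    (h : 'I_r -> X -> R) (p : {fset X}) :
  is_cycle h p -> exists lam : {ffun p -> R}, normalized_cycle_vector h lam.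
Proof.
move=> [/fset0Pn[x0 x0p] [lam [lam0 lamh]]].
set s := \sum_(x : p) `|lam x|.
have s_gt0 : 0 < s.
  rewrite /s (bigD1 [` x0p]%fset) //= ltr_pwDl ?normr_gt0 //.
  by apply: sumr_ge0 => x _; exact: normr_ge0.
exists [ffun x => s^-1 * lam x]; split; first split.
- by move=> x; rewrite ffunE mulf_neq0 // invr_eq0 gt_eqF.
- move=> i t; under eq_bigr do rewrite ffunE -mulrA.
  by rewrite -mulr_sumr lamh mulr0.
- under eq_bigr do rewrite ffunE normrM gtr0_norm ?invr_gt0 //.
  by rewrite -mulr_sumr mulVf // gt_eqF.
Qed.

Lemma cycle_weightsP (R : realType) (X : choiceType) (r : nat)
    (h : 'I_r -> X -> R) (p : {fset X}) :
  is_cycle h p -> normalized_cycle_vector h (cycle_weights h p).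
Proof. by move=> /normalized_cycle_vector_ex/xgetPex; apply. Qed.

Lemma cycle_vector_colinear (R : realType) (X : choiceType) (r : nat)
    (h : 'I_r -> X -> R) (p : {fset X}) (lam mu : {ffun p -> R}) :
  minimal_cycle h p -> cycle_vector h lam -> cycle_vector h mu ->
  exists c : R, forall x, mu x = c * lam x.
Proof.
move=> [[/fset0Pn[x0 x0p] _] pmin] [lam0 lamh] [_ muh].
pose y0 : p := [` x0p]%fset; pose c := mu y0 / lam y0; exists c.
pose nu x := mu x - c * lam x.
pose ext (x : X) : R := if insub x is Some y then nu y else 0.
have extE (y : p) : ext (val y) = nu y by rewrite /ext valK.
pose q := [fset x in p | ext x != 0]%fset.
have qp : (q `<` p)%fset.
  apply/andP; split; first by apply/fsubsetP => x; rewrite !inE /= => /andP[].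
  apply/fsubsetPn; exists x0 => //; rewrite !inE /= x0p /= negbK.
  have -> : x0 = val y0 by [].
  by rewrite extE /nu /c divfK // subrr.
suff q0 : q = fset0.
  move=> x; apply/eqP; rewrite -subr_eq0 -/(nu x) -extE; apply/negPn/negP => nz.
  by have := in_fset0 (val x); rewrite -q0 !inE /= nz (valP x).
apply/eqP/negPn/negP => qn0; apply: (pmin q qp); split=> //.
exists [ffun y => ext (val y)]; split.
  by move=> y; rewrite ffunE; have := valP y; rewrite !inE /= => /andP[].
move=> i t; under eq_bigr do rewrite ffunE.
rewrite -(big_seq_fsetE _ _ predT (fun y => ext y * \1_[set h i y] t)) /=.
transitivity (\sum_(y <- p) ext y * \1_[set h i y] t).
  apply: big_fset_incl; first exact: fproper_sub.
  move=> x xp; rewrite !inE /= xp /= negbK => /eqP ->.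
  by rewrite mul0r.
rewrite big_seq_fsetE /=; under eq_bigr do rewrite extE mulrBl -mulrA.
by rewrite sumrB -mulr_sumr lamh muh mulr0 subrr.
Qed.

Lemma normalized_cycle_vector_uniq (R : realType) (X : choiceType) (r : nat)
    (h : 'I_r -> X -> R) (p : {fset X}) (lam mu : {ffun p -> R}) :
  minimal_cycle h p -> normalized_cycle_vector h lam ->
  normalized_cycle_vector h mu -> mu = lam \/ mu = - lam.
Proof.
move=> pmin [hlam lam1] [hmu mu1].
have [c muE] := cycle_vector_colinear pmin hlam hmu.
have /eqP : `|c| = 1.
  rewrite -mu1 -[LHS]mulr1 -lam1 mulr_sumr.
  by apply: eq_bigr => x _; rewrite muE normrM.
rewrite eqr_norml ler01 andbT => /orP[]/eqP cE; [left|right];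
  by apply/ffunP => x; rewrite ?ffunE muE cE ?mul1r ?mulN1r.
Qed.

(* Main.v *)
(** Finding the functions [g i] amounts to solving the linear system
    [\sum_i u (i, h i x) = f x], one equation for each [x], in the unknowns
    [u (i, t)]. By extension of linear forms, such a system is solvable as soon
    as every finite linear dependency between its rows also holds between its
    right-hand sides. The support of a dependency between the rows is a cycle,
    and subtracting multiples of smaller cycles reduces to minimal ones. *)

Require Import Defs.
From mathcomp Require Import all_boot all_order all_algebra.
From mathcomp Require Import all_classical all_reals.
From mathcomp Require Import numfun.

Local Open Scope classical_set_scope.
Local Open Scope ring_scope.

Set Implicit Arguments.
Unset Strict Implicit.

Import GRing.Theory Num.Theory.

(** Zorn's lemma is applied to the linear single-valued relations extending [G]. A maximal one is
    defined on all of [V], hence is the graph of a linear form. *)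
Lemma scalar_graph_extension (K : fieldType) (V : lmodType K)
    (G : set (V * K^o)) :
  G 0 -> (forall a u v, G u -> G v -> G (a *: u + v)) ->
  (forall y, G (0, y) -> y = 0) ->
  exists2 phi : V -> K, scalar phi & forall w, G w -> phi w.1 = w.2.
Proof.
move=> G0 Glin Gfun.
(* The clause [A !=set0 -> G `<=` A] lets the union of the empty chain in. *)
pose P (A : set (V * K^o)) := [/\ A !=set0 -> G `<=` A,
  forall a u v, A u -> A v -> A (a *: u + v) &
  forall y, A (0, y) -> y = 0].
have [F FP totF|A [[AG Alin Afun] Amax]] := @Zorn_bigcup _ P.
  split.
  - move=> [w [B FB Bw]] u Gu; exists B => //.
    by have [+ _ _] := FP _ FB; apply=> //; exists w.
  - move=> a u v [B FB Bu] [C FC Cv].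
    have [_ Blin _] := FP _ FB; have [_ Clin _] := FP _ FC.
    have [BC|CB] := totF _ _ FB FC.
      by exists C => //; apply: Clin => //; exact: BC.
    by exists B => //; apply: Blin => //; exact: CB.
  - by move=> y [B FB By]; have [_ _] := FP _ FB; apply.
have A0 : A !=set0.
  (* The empty relation is not maximal: [G] contains 0 and properly extends it. *)
  apply/set0P/negP => /eqP A0; apply: (Amax G); last by split=> //= _.
  by rewrite A0; split=> // GA; exact: (GA 0).
have {}AG := AG A0.
have AZ a u : A u -> A (a *: u).
  by move=> Au; rewrite -[_ *: _]addr0; apply: Alin => //; exact: AG.
have AB u v : A u -> A v -> A (u - v).
  by move=> Au Av; rewrite addrC -scaleN1r; exact: Alin.
have Atot u : exists y, A (u, y).
  apply: contrapT => nAu.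
  (* [B] is the sum of [A] and the line through [(u, 0)]: it extends [A] by the value 0 at [u]. *)
  pose B : set (V * K^o) := [set w | exists c : K, A (w.1 - c *: u, w.2)].
  have AsubB : A `<=` B.
    by move=> [v y] Av; exists 0; rewrite scale0r subr0.
  apply: (Amax B).
    split=> // BA; apply: nAu; exists 0; apply: BA.
    by exists 1; rewrite scale1r subrr; exact: AG.
  split.
  - by move=> _ w Gw; apply: AsubB; exact: AG.
  - move=> a [v y] [w z] /= [c Ac] [e Ae]; exists (a * c + e) => /=.
    suff -> : a *: v + w - (a * c + e) *: u = a *: (v - c *: u) + (w - e *: u).
      exact: (Alin a _ _ Ac Ae).
    by rewrite scalerDl scalerBr opprD scalerA addrACA.
  - move=> y [c /=]; rewrite sub0r; have [->|c0] := eqVneq c 0.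
      by rewrite scale0r oppr0 => /Afun.
    (* Dividing by the nonzero coefficient would put [u] in the domain of [A]. *)
    move=> /(AZ (- c^-1)) Au; exfalso; apply: nAu; exists (- c^-1 *: y).
    move: Au; congr A; congr pair.
    by rewrite /= scalerN scaleNr opprK scalerA mulVf // scale1r.
have [phi phiA] := choice Atot.
have phiE u y : A (u, y) -> phi u = y.
  move=> Au; apply/eqP; rewrite -subr_eq0; apply/eqP/Afun.
  by have := AB _ _ (phiA u) Au; congr A; congr pair; rewrite /= subrr.
exists phi.
  by move=> a u v; apply: phiE; exact: (Alin a _ _ (phiA u) (phiA v)).
by move=> [u y] /AG /phiE.
Qed.

(** Padding with zero weights lets dependencies with different supports be combined over a common
    set. *)
Lemma big_fset_extend (K : pzRingType) (V : lmodType K) (X : choiceType)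
    (p q : {fset X}) (lam : X -> K) (F : X -> V) : (p `<=` q)%fset ->
  \sum_(x <- p) lam x *: F x =
  \sum_(x <- q) (if x \in p then lam x else 0) *: F x.
Proof.
move=> pq; transitivity
    (\sum_(x <- p) (if x \in p then lam x else 0) *: F x).
  by rewrite !big_seq; apply: eq_bigr => x ->.
by apply: big_fset_incl => // x _ /negbTE ->; rewrite scale0r.
Qed.

(** The pairs [(v x, f x)] span a subspace of [V * K^o]. The hypothesis on dependencies says that
    its only element over 0 is 0, so it is the graph of a partial linear form. *)
Lemma scalar_interpolation (K : fieldType) (V : lmodType K) (X : choiceType)
    (v : X -> V) (f : X -> K) :
  (forall (p : {fset X}) (lam : X -> K),
     \sum_(x <- p) lam x *: v x = 0 -> \sum_(x <- p) lam x * f x = 0) ->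
  exists2 phi : V -> K, scalar phi & forall x, phi (v x) = f x.
Proof.
move=> dep.
pose F x : V * K^o := (v x, f x).
pose G : set (V * K^o) := [set w | exists (p : {fset X}) (lam : X -> K),
  w = \sum_(x <- p) lam x *: F x].
have [||y [p [lam]]|phi phil phiG] := @scalar_graph_extension K V G.
- by exists fset0, (fun=> 0); rewrite big_seq_fset0.
- move=> a _ _ [p [lam ->]] [q [mu ->]].
  exists (p `|` q)%fset, (fun x => a * (if x \in p then lam x else 0)
                                  + (if x \in q then mu x else 0)).
  rewrite (big_fset_extend _ _ (fsubsetUl p q)).
  rewrite (big_fset_extend _ _ (fsubsetUr p q)).
  rewrite scaler_sumr -big_split /=; apply: eq_bigr => x _.
  by rewrite scalerA -scalerDl.
- move=> yE.
  have := congr1 fst yE; have := congr1 snd yE; rewrite /= !raddf_sum /=.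
  by move=> -> /esym/dep.
- exists phi => // x; apply: (phiG (F x)).
  by exists [fset x]%fset, (fun=> 1); rewrite big_seq_fset1 scale1r.
Qed.

Lemma sum_fset_finsupp_extension (R : pzRingType) (X : choiceType)
    (p : {fset X}) (lam : {ffun p -> R}) :
  exists2 mu : X -> R, (forall x : p, mu (val x) = lam x) &
    forall F : X -> R,
      \sum_(x : p) lam x * F (val x) = \sum_(x <- p) mu x * F x.
Proof.
pose mu (x : X) : R := if insub x is Some y then lam y else 0.
have muE (x : p) : mu (val x) = lam x by rewrite /mu valK.
exists mu => // F; rewrite big_seq_fsetE /=.
by apply: eq_bigr => x _; rewrite muE.
Qed.

(** On the finitely many values that [h i] takes on [p], [g i] is a linear combination of
    characteristic functions of points, and the cycle equations annihilate each of these. *)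
Lemma cycle_annihilates_superposition (R : realType) (X : choiceType) (r : nat)
    (h : 'I_r -> X -> R) (f : X -> R) (p : {fset X}) (lam : {ffun p -> R}) :
  superpositions h f -> cycle_vector h lam ->
  \sum_(x : p) lam x * f (val x) = 0.
Proof.
move=> [g fE] [_ lamh]; under eq_bigr do rewrite fE mulr_sumr.
rewrite exchange_big big1 // => i _.
pose T := [fset h i (val x) | x : p]%fset.
have gE (x : p) :
    g i (h i (val x)) = \sum_(t <- T) \1_[set h i (val x)] t * g i t.
  rewrite (big_fsetD1 (h i (val x))) /=; last by apply/imfsetP; exists x.
  rewrite indicE mem_set // mul1r big_seq big1 ?addr0 // => t.
  by rewrite !inE indicE => /andP[/eqP tx _]; rewrite memNset ?mul0r.
under eq_bigr do rewrite gE mulr_sumr.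
rewrite exchange_big big1 // => t _ /=.
by under eq_bigr do rewrite mulrA; rewrite -mulr_suml lamh mul0r.
Qed.

(** Strong induction on the number of points. Weights are allowed to vanish, so that dependencies on
    [p] are closed under linear combinations. *)
Lemma dependency_annihilates (R : realType) (X : choiceType) (r : nat)
    (h : 'I_r -> X -> R) (f : X -> R) :
  (forall p, minimal_cycle h p -> cycle_functional h p f = 0) ->
  forall (p : {fset X}) (lam : X -> R),
    (forall i t, \sum_(x <- p) lam x * \1_[set h i x] t = 0) ->
    \sum_(x <- p) lam x * f x = 0.
Proof.
move=> fmin p; have [n] := ubnP #|` p|%fset.
elim: n p => // n IH p pn lam lamh.
(* A dependency with a zero weight is supported on a smaller set. *)
have drop (x0 : X) (mu : X -> R) : x0 \in p -> mu x0 = 0 ->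
    (forall i t, \sum_(x <- p) mu x * \1_[set h i x] t = 0) ->
    \sum_(x <- p) mu x * f x = 0.
  move=> x0p mu0 muh.
  have dropE (F : X -> R) :
      \sum_(x <- p) mu x * F x = \sum_(x <- (p `\ x0)%fset) mu x * F x.
    by rewrite (big_fsetD1 x0) //= mu0 mul0r add0r.
  rewrite dropE; apply: IH => [|i t].
    by move: pn; rewrite (cardfsD1 x0 p) x0p.
  by rewrite -(dropE (fun x => \1_[set h i x] t)) muh.
have [[x0 x0p lam0]|lamN0] := pselect (exists2 x, x \in p & lam x = 0).
  exact: (drop x0).
have [->|p0] := eqVneq p fset0; first by rewrite big_seq_fset0.
pose lamp := [ffun x : p => lam (val x)].
have lampE (F : X -> R) :
    \sum_(x : p) lamp x * F (val x) = \sum_(x <- p) lam x * F x.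
  by rewrite big_seq_fsetE /=; apply: eq_bigr => x _; rewrite ffunE.
have lampv : cycle_vector h lamp.
  split=> [x|i t]; last by rewrite -[RHS](lamh i t) -lampE.
  rewrite ffunE; apply/eqP => lx; apply: lamN0.
  by exists (val x) => //; exact: valP.
have pc : is_cycle h p by split=> //; exists lamp.
have [pmin|pNmin] := pselect (minimal_cycle h p).
  (* On a minimal cycle the weights are a multiple of those of the cycle functional. *)
  have [c lamE] :=
    cycle_vector_colinear pmin (cycle_weightsP pc).1 lampv.
  rewrite -lampE; under eq_bigr do rewrite lamE -mulrA.
  by rewrite -mulr_sumr [X in _ * X](fmin p pmin) mulr0.
have [q qp [/fset0Pn[x0 x0q] [mu' [mu'0 mu'h]]]] :
    exists2 q, (q `<` p)%fset & is_cycle h q.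
  apply: contrapT => nq; apply: pNmin; split=> // q qp qc.
  by apply: nq; exists q.
have [mu muE musum] := sum_fset_finsupp_extension mu'.
have muh i t : \sum_(x <- q) mu x * \1_[set h i x] t = 0.
  by rewrite -(musum (fun x => \1_[set h i x] t)); exact: mu'h.
have mux0 : mu x0 != 0 by have := mu'0 [` x0q]%fset; rewrite -muE.
have muf : \sum_(x <- q) mu x * f x = 0.
  by apply: IH => //; exact: leq_trans (fproper_ltn_card qp) _.
(* Cancel the weight at [x0] by subtracting a multiple of the smaller cycle. *)
pose c := lam x0 / mu x0.
pose nu x := lam x - c * (if x \in q then mu x else 0).
have nuE (F : X -> R) : \sum_(x <- p) nu x * F x =
    \sum_(x <- p) lam x * F x - c * \sum_(x <- q) mu x * F x.
  have := @big_fset_extend _ R^o _ _ _ mu F (fproper_sub qp).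
  rewrite /GRing.scale /= => ->; rewrite mulr_sumr -sumrB.
  by apply: eq_bigr => x _; rewrite mulrBl mulrA.
(* [nu] may vanish at further points, or everywhere; only its zero at [x0] matters. *)
have := drop x0 nu; rewrite nuE muf mulr0 subr0; apply.
- exact: (fsubsetP (fproper_sub qp)).
- by rewrite /nu x0q /c divfK // subrr.
- by move=> i t; rewrite nuE lamh muh mulr0 subrr.
Qed.

Lemma superpositions_of_annihilated (R : realType) (X : choiceType) (r : nat)
    (h : 'I_r -> X -> R) (f : X -> R) :
  (forall p, minimal_cycle h p -> cycle_functional h p f = 0) ->
  superpositions h f.
Proof.
move=> /dependency_annihilates fdep.
(* [e i t] is the unit vector of the unknown [(i, t)], and [v x] is the row of the equation at
   [x]. *)
pose e i t : 'I_r * R -> R := \1_[set (i, t)].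
pose v x : 'I_r * R -> R := \sum_(i < r) e i (h i x).
have vE i t x : v x (i, t) = \1_[set h i x] t.
  rewrite /v fct_sumE (bigD1 i) //= big1 ?addr0 => [|j ji].
    rewrite /e !indicE; congr (_ %:R); congr nat_of_bool.
    by apply/idP/idP; rewrite !inE /= => tE; [case: tE|rewrite tE].
  rewrite /e indicE memNset // => -[/esym/eqP].
  by rewrite (negbTE ji).
have [p lam sum0|phi phil phiv] := @scalar_interpolation R ('I_r * R -> R^o) X v f.
  apply: fdep => i t; have := congr1 (fun w => w (i, t)) sum0.
  rewrite fct_sumE => sum_it; apply: etrans sum_it.
  by apply: eq_bigr => x _; rewrite -vE.
have phi0 : phi 0 = 0.
  by have := phil (-1) 0 0; rewrite scaler0 addr0 mulN1r addNr.
have phiD u w : phi (u + w) = phi u + phi w.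
  by have := phil 1 u w; rewrite scale1r mul1r.
(* The value of the linear form at a unit vector is the value of the corresponding unknown. *)
exists (fun i t => phi (e i t)) => x.
by rewrite -phiv /v (big_morph phi phiD phi0).
Qed.

Theorem theorem1p1 (R : realType) (d r : nat) (X : set 'rV[R]_d)
    (h : 'I_r -> X -> R) :
  ((exists p : {fset X}, is_cycle h p) ->
     forall f : X -> R,
       superpositions h f <->
       (forall p : {fset X}, minimal_cycle h p -> cycle_functional h p f = 0))
  /\
  ((forall p : {fset X}, ~ is_cycle h p) ->
     superpositions h = [set: X -> R]).
Proof.
split=> [_ f|nocycle].
  split=> [fB p [pc _]|]; last exact: superpositions_of_annihilated.
  exact: (cycle_annihilates_superposition fB (cycle_weightsP pc).1).
(* Without cycles the condition on minimal cycles is vacuous. *)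
apply/seteqP; split=> // f _; apply: superpositions_of_annihilated => p [pc _].
by have := nocycle p pc.
Qed.
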